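(* For every $k\ge1$, $$G_k(z)=\sum_{\widetilde\Gamma\in\widetilde{\mathcal G}_k}\frac1{|\mathrm{Aut}(\widetilde\Gamma)|}\prod_{v\in V(\widetilde\Gamma)}V_{\mathrm{val}_v}(z),$$ where $\widetilde{\mathcal G}_k$ is the set of isomorphism classes of all connected graphs with unmarked vertices (no genus assigned to the vertices, no stability condition; loops and multiple edges allowed), with exactly $k$ internal edges and no external edges, and $V(\widetilde\Gamma)$ is the vertex set.
   Context: Stable graphs: a stable graph is a finite graph (loops and multiple edges allowed) with internal edges, each joining two (possibly equal) vertices, and unlabelled external edges, each attached to one vertex. Each vertex $v$ carries a genus $g_v\in\mathbb Z_{\ge0}$; its valence $\mathrm{val}_v$ is the number of half-edges at $v$ (an external edge counts once, a loop twice); stability means $2g_v-2+\mathrm{val}_v>0$ for every $v$. The genus of a connected stable graph $\Gamma$ is $h^1(\Gamma)+\sum_v g_v$. $\mathcal G^c_{g,0}$ is the (finite) set of isomorphism classes of connected stable graphs of genus $g$ with no external edges; $V(\Gamma)$, $E(\Gamma)$ are the sets of vertices and internal edges. In all cases $\mathrm{Aut}$ denotes the automorphism group acting on vertices and half-edges. For $2g-2+n>0$, $\chi(\mathcal M_{g,n})=(-1)^n\frac{(2g-1)B_{2g}}{(2g)!}(2g+n-3)!$ is the orbifold Euler characteristic of $\mathcal M_{g,n}$ (Harer–Zagier formula). For $g\ge2$, $k\ge0$ let $a_{g,0}^k$ be the coefficient of $\kappa^k$ in $\widetilde\chi_{g,0}(\kappa)=\sum_{\Gamma\in\mathcal G^c_{g,0}}\frac{\kappa^{|E(\Gamma)|}}{|\mathrm{Aut}(\Gamma)|}\prod_{v}\chi(\mathcal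 M_{g_v,\mathrm{val}_v})$, and let $G_k(z):=\sum_{g\ge2}a_{g,0}^kz^{2-2g}$ (formal series in $z^{-1}$). Also $V_n(z):=\sum_{g\ge1}\chi(\mathcal M_{g,n})z^{2-2g-n}$ for $n=1,2$ and $V_n(z):=\sum_{g\ge0}\chi(\mathcal M_{g,n})z^{2-2g-n}$ for $n\ge3$, as formal series in $z^{-1}$. *)

(* Defs.v *)
From HB Require Import structures.
From mathcomp Require Import all_boot all_order all_algebra perm.
From mathcomp Require Import boolp classical_sets fsbigop.

Set Implicit Arguments.
Unset Strict Implicit.
Unset Printing Implicit Defensive.
Import GRing.Theory.

Local Open Scope ring_scope.
Local Open Scope quotient_scope.
Local Open Scope classical_set_scope.

(** * Formal series in [z^-1]

    A series [\sum_m s_m z^-m] over the rationals is given by its coefficients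
    [coef s m = s_m]; the product is the Cauchy product. *)

Record fps := FPS { coef : nat -> rat }.

HB.instance Definition _ := gen_eqMixin fps.
HB.instance Definition _ := gen_choiceMixin fps.

Lemma fpsP (s t : fps) : coef s =1 coef t -> s = t.
Proof. by case: s t => [s] [t] /= /funext ->. Qed.

Definition fps_zero := FPS (fun=> 0).
Definition fps_one := FPS (fun m => (m == 0%N)%:R).
Definition fps_opp s := FPS (fun m => - coef s m).
Definition fps_add s t := FPS (fun m => coef s m + coef t m).
Definition fps_mul s t :=
  FPS (fun m => \sum_(i < m.+1) coef s i * coef t (m - i)%N).
Definition fps_scale (c : rat) s := FPS (fun m => c * coef s m).

Fact fps_addA : associative fps_add.
Proof. by move=> s t u; apply: fpsP => m /=; rewrite addrA. Qed.
Fact fps_addC : commutative fps_add.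
Proof. by move=> s t; apply: fpsP => m /=; rewrite addrC. Qed.
Fact fps_add0 : left_id fps_zero fps_add.
Proof. by move=> s; apply: fpsP => m /=; rewrite add0r. Qed.
Fact fps_addN : left_inverse fps_zero fps_opp fps_add.
Proof. by move=> s; apply: fpsP => m /=; rewrite addNr. Qed.

HB.instance Definition _ :=
  GRing.isZmodule.Build fps fps_addA fps_addC fps_add0 fps_addN.

Fact fps_mulC : commutative fps_mul.
Proof.
move=> s t; apply: fpsP => m /=; rewrite (reindex_inj rev_ord_inj) /=.
by apply: eq_bigr => i _; rewrite subSS subKn 1?mulrC // -ltnS.
Qed.

Fact fps_mulA : associative fps_mul.
Proof.
have rev (s t : fps) m :
    coef (fps_mul s t) m = \sum_(j < m.+1) coef s (m - j)%N * coef t j.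
  by rewrite fps_mulC; apply: eq_bigr => i _; rewrite mulrC.
move=> p q r; apply: fpsP => i; rewrite [RHS]rev.
pose coef3 j k := coef p j * (coef q (i - j - k)%N * coef r k).
transitivity (\sum_(j < i.+1) \sum_(k < i.+1 | (k <= i - j)%N) coef3 j k).
  apply: eq_bigr => /= j _; rewrite -[X in _ * X]/(coef (fps_mul q r) (i - j)).
  by rewrite rev big_distrr /= (big_ord_narrow_leq (leq_subr _ _)).
rewrite (exchange_big_dep predT) //=; apply: eq_bigr => k _.
transitivity (\sum_(j < i.+1 | (j <= i - k)%N) coef3 j k).
  apply: eq_bigl => j; rewrite -ltnS -(ltnS j) -!subSn ?leq_ord //.
  by rewrite -subn_gt0 -(subn_gt0 j) -!subnDA addnC.
rewrite (big_ord_narrow_leq (leq_subr _ _)) big_distrl /=.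
by apply: eq_bigr => j _; rewrite /coef3 -!subnDA addnC mulrA.
Qed.

Fact fps_mul1 : left_id fps_one fps_mul.
Proof.
move=> s; apply: fpsP => m /=; rewrite big_ord_recl mul1r subn0.
by rewrite big1 ?addr0 // => i _; rewrite mul0r.
Qed.

Fact fps_mulDl : left_distributive fps_mul fps_add.
Proof.
move=> s t u; apply: fpsP => m /=; rewrite -big_split.
by apply: eq_bigr => i _; rewrite mulrDl.
Qed.

Fact fps_one_neq0 : fps_one != fps_zero.
Proof. by apply/eqP => /(congr1 (coef^~ 0%N)) /eqP; rewrite oner_eq0. Qed.

HB.instance Definition _ := GRing.Zmodule_isComNzRing.Build fps
  fps_mulA fps_mulC fps_mul1 fps_mulDl fps_one_neq0.

Fact fps_scaleA a b s : fps_scale a (fps_scale b s) = fps_scale (a * b) s.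
Proof. by apply: fpsP => m /=; rewrite mulrA. Qed.
Fact fps_scale1 : left_id 1 fps_scale.
Proof. by move=> s; apply: fpsP => m /=; rewrite mul1r. Qed.
Fact fps_scaleDr : right_distributive fps_scale +%R.
Proof. by move=> a s t; apply: fpsP => m /=; rewrite mulrDr. Qed.
Fact fps_scaleDl s : {morph fps_scale^~ s : a b / a + b}.
Proof. by move=> a b; apply: fpsP => m /=; rewrite mulrDl. Qed.

HB.instance Definition _ := GRing.Zmodule_isLmodule.Build rat fps
  fps_scaleA fps_scale1 fps_scaleDr fps_scaleDl.

(** * Orbifold Euler characteristics of moduli spaces of curves *)

(** [bernoulli_seq n] is [:: B_0; ...; B_(n-1)]. *)
Fixpoint bernoulli_seq (n : nat) : seq rat :=
  if n is m.+1 then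
    let s := bernoulli_seq m in
    rcons s ((m == 0%N)%:R
             - m.+1%:R^-1 * \sum_(j < m) 'C(m.+1, j)%:R * s`_j)
  else [::].

Definition bernoulli (n : nat) : rat := (bernoulli_seq n.+1)`_n.

Lemma bernoulli_sum n :
  \sum_(j < n.+1) 'C(n.+1, j)%:R * bernoulli j = (n == 0%N)%:R.
Proof.
have sz m : size (bernoulli_seq m) = m.
  by elim: m => //= m IH; rewrite size_rcons IH.
have nthE m j : (j < m)%N -> (bernoulli_seq m)`_j = bernoulli j.
  elim: m => // m IH; rewrite ltnS leq_eqVlt => /predU1P[-> //|ltjm].
  by rewrite /= nth_rcons sz ltjm IH.
rewrite big_ord_recr /= binSn.
rewrite [bernoulli n]/bernoulli /= nth_rcons sz ltnn eqxx.
have -> : \sum_(j < n) 'C(n.+1, j)%:R * (bernoulli_seq n)`_j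
          = \sum_(j < n) 'C(n.+1, j)%:R * bernoulli j.
  by apply: eq_bigr => j _; rewrite nthE.
have nz : n.+1%:R != 0 :> rat by rewrite Num.Theory.pnatr_eq0.
rewrite mulrBr mulVKf // addrCA subrr addr0.
by case: n {nz} => [|n]; rewrite ?mulr1 ?mulr0.
Qed.

(** Harer-Zagier formula for [chi(M_{g,n})]; only meaningful when
    [2 g - 2 + n > 0], in which case the subtraction is exact. *)
Definition chiM (g n : nat) : rat :=
  (-1) ^+ n * ((2 * g)%:R - 1) * bernoulli (2 * g) / (2 * g)`!%:R
  * (2 * g + n - 3)`!%:R.

(** * Graphs

    A finite graph is given by its vertices, its half-edges, the vertex each
    half-edge is attached to and the involution exchanging the two halves of
    every internal edge; the fixed points of the involution are the external
    edges. Working up to isomorphism, vertices and half-edges are ordinals. *)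

Record graph := Graph {
  nvert : nat;
  nhalf : nat;
  vert : 'I_nhalf -> 'I_nvert;
  flip : 'I_nhalf -> 'I_nhalf;
  flipK : involutive flip
}.

(** A graph with a genus at each vertex. *)
Record ggraph := GGraph {
  ggraph_graph :> graph;
  vgenus : 'I_(nvert ggraph_graph) -> nat
}.

HB.instance Definition _ := gen_eqMixin graph.
HB.instance Definition _ := gen_choiceMixin graph.
HB.instance Definition _ := gen_eqMixin ggraph.
HB.instance Definition _ := gen_choiceMixin ggraph.

Section GraphNotions.
Variable G : graph.

(** External edges count once, loops twice. *)
Definition valence (v : 'I_(nvert G)) : nat := #|[set h | vert h == v]%SET|.

Definition edges : {set {set 'I_(nhalf G)}} :=
  [set [set h; flip h]%SET | h : 'I_(nhalf G) & flip h != h]%SET.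

Definition nedges : nat := #|edges|.

Definition no_external : bool := [forall h : 'I_(nhalf G), flip h != h].

Definition adjacent : rel 'I_(nvert G) :=
  fun u v => [exists h, (vert h == u) && (vert (flip h) == v)].

Definition connected_graph : bool :=
  (0 < nvert G)%N && [forall u, forall v, connect adjacent u v].

(** The coboundary [C^0(G) -> C^1(G)], sending a function [f] on the vertices
    to [h |-> f (vert h) - f (vert (flip h))]. The 1-cochains are the functions
    on half-edges that are antisymmetric under [flip]; they form a space of
    dimension [nedges]. *)
Definition coboundary : 'M[rat]_(nvert G, nhalf G) :=
  \matrix_(v, h) ((vert h == v)%:R - (vert (flip h) == v)%:R).

(** [dim H^1 = dim C^1 - rank of the coboundary]. *)
Definition h1 : nat := (nedges - \rank coboundary)%N.

End GraphNotions.

Definition genus (G : ggraph) : nat := (h1 G + \sum_v vgenus (g := G) v)%N.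

(** [2 g_v - 2 + val_v > 0] at every vertex. *)
Definition stable (G : ggraph) : bool :=
  [forall v : 'I_(nvert G), (2 < 2 * vgenus v + valence v)%N].

(** ** Isomorphisms and automorphisms *)

Definition graph_mor (G H : graph) (f : 'I_(nvert G) -> 'I_(nvert H))
    (p : 'I_(nhalf G) -> 'I_(nhalf H)) : bool :=
  [forall h, vert (p h) == f (vert h)] && [forall h, flip (p h) == p (flip h)].

Definition ggraph_mor (G H : ggraph) (f : 'I_(nvert G) -> 'I_(nvert H))
    (p : 'I_(nhalf G) -> 'I_(nhalf H)) : bool :=
  graph_mor f p && [forall v, vgenus (f v) == vgenus v].

Definition graph_iso (G H : graph) : bool :=
  `[< exists f p, [/\ bijective f, bijective p & @graph_mor G H f p] >].

Definition ggraph_iso (G H : ggraph) : bool :=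
  `[< exists f p, [/\ bijective f, bijective p & @ggraph_mor G H f p] >].

Definition graph_Aut (G : graph) : {set 'S_(nvert G) * 'S_(nhalf G)} :=
  [set s : 'S_(nvert G) * 'S_(nhalf G) | @graph_mor G G s.1 s.2]%SET.

Definition ggraph_Aut (G : ggraph) : {set 'S_(nvert G) * 'S_(nhalf G)} :=
  [set s : 'S_(nvert G) * 'S_(nhalf G) | @ggraph_mor G G s.1 s.2]%SET.

Lemma graph_mor_id G : @graph_mor G G id id.
Proof. by apply/andP; split; apply/forallP => h. Qed.

Lemma graph_mor_comp G H K f p f' p' : @graph_mor G H f p ->
  @graph_mor H K f' p' -> @graph_mor G K (f' \o f) (p' \o p).
Proof.
move=> /andP[/forallP vp /forallP fp] /andP[/forallP vp' /forallP fp'].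
apply/andP; split; apply/forallP => h /=.
- by rewrite (eqP (vp' _)) (eqP (vp _)).
- by rewrite (eqP (fp' _)) (eqP (fp _)).
Qed.

Lemma graph_mor_inv G H f p f' p' : cancel f f' -> cancel p' p ->
  cancel p p' -> @graph_mor G H f p -> @graph_mor H G f' p'.
Proof.
move=> fK p'K pK /andP[/forallP vp /forallP fp].
apply/andP; split; apply/forallP => h; apply/eqP.
- by rewrite -{2}[h]p'K (eqP (vp _)) fK.
- by rewrite -{2}[h]p'K (eqP (fp _)) pK.
Qed.

Fact graph_iso_refl : reflexive graph_iso.
Proof.
move=> G; apply/asboolP; exists id, id; split; first by exists id.
  by exists id.
exact: graph_mor_id.
Qed.

Fact graph_iso_sym : symmetric graph_iso.
Proof.
suff imp G H : graph_iso G H -> graph_iso H G.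
  by move=> G H; apply/idP/idP; apply: imp.
move=> /asboolP[f [p [[f' fK f'K] [p' pK p'K] m]]].
apply/asboolP; exists f', p'; split; [by exists f|by exists p|].
exact: graph_mor_inv m.
Qed.

Fact graph_iso_trans : transitive graph_iso.
Proof.
move=> H G K /asboolP[f [p [bf bp m]]] /asboolP[f' [p' [bf' bp' m']]].
apply/asboolP; exists (f' \o f), (p' \o p).
by split; [exact: bij_comp|exact: bij_comp|exact: graph_mor_comp m m'].
Qed.

Fact ggraph_iso_refl : reflexive ggraph_iso.
Proof.
move=> G; apply/asboolP; exists id, id; split; first by exists id.
  by exists id.
by rewrite /ggraph_mor graph_mor_id; apply/forallP => v.
Qed.

Fact ggraph_iso_sym : symmetric ggraph_iso.
Proof.
suff imp G H : ggraph_iso G H -> ggraph_iso H G.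
  by move=> G H; apply/idP/idP; apply: imp.
move=> /asboolP[f [p [[f' fK f'K] [p' pK p'K] /andP[m /forallP gm]]]].
apply/asboolP; exists f', p'; split; [by exists f|by exists p|].
rewrite /ggraph_mor (graph_mor_inv fK p'K pK m) /=.
by apply/forallP => v; rewrite -{2}[v]f'K eq_sym.
Qed.

Fact ggraph_iso_trans : transitive ggraph_iso.
Proof.
move=> H G K /asboolP[f [p [bf bp /andP[m /forallP gm]]]].
move=> /asboolP[f' [p' [bf' bp' /andP[m' /forallP gm']]]].
apply/asboolP; exists (f' \o f), (p' \o p).
split; [exact: bij_comp|exact: bij_comp|].
rewrite /ggraph_mor (graph_mor_comp m m') /=.
by apply/forallP => v /=; rewrite (eqP (gm' _)) gm.
Qed.

Canonical graph_iso_equiv :=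
  EquivRel graph_iso graph_iso_refl graph_iso_sym graph_iso_trans.
Canonical ggraph_iso_equiv :=
  EquivRel ggraph_iso ggraph_iso_refl ggraph_iso_sym ggraph_iso_trans.

(** Isomorphism classes; [repr c] is a representative of the class [c]. *)
Definition graph_class := {eq_quot graph_iso_equiv}.
Definition ggraph_class := {eq_quot ggraph_iso_equiv}.

(** ** The sets of graphs and the generating series *)

(** Isomorphism classes of connected stable graphs of genus [g] without
    external edges. This set is finite, so that finitely supported sums over
    it are the usual sums. *)
Definition stable_graphs (g : nat) : set ggraph_class :=
  [set c : ggraph_class | [&& connected_graph (repr c), stable (repr c),
                              no_external (repr c) & genus (repr c) == g]].

(** Isomorphism classes of connected graphs with [k] internal edges and no
    external ones; this set is finite as well. *)
Definition plain_graphs (k : nat) : set graph_class :=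
  [set c : graph_class | [&& connected_graph (repr c), no_external (repr c)
                           & nedges (repr c) == k]].

(** The polynomial [\tilde\chi_{g,0}(kappa)]. *)
Definition tchi (g : nat) : {poly rat} :=
  \sum_(c \in stable_graphs g)
    (#|ggraph_Aut (repr c)|%:R^-1
     * \prod_(v < nvert (repr c)) chiM (vgenus v) (valence v))
    *: 'X^(nedges (repr c)).

(** [a_{g,0}^k] *)
Definition acoef (g k : nat) : rat := (tchi g)`_k.

(** [\sum_(g >= 2) a_{g,0}^k z^(2-2g)]: the coefficient of [z^-m] collects the
    [g >= 2] with [2 g - 2 = m], all of which are at most [m + 2]. *)
Definition Gser (k : nat) : fps :=
  FPS (fun m => \sum_(2 <= g < m.+3 | (2 * g == m + 2)%N) acoef g k).

(** [\sum_g chi(M_{g,n}) z^(2-2g-n)] for [n >= 1], over [g >= 1] if [n <= 2] and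
    [g >= 0] if [n >= 3]: the coefficient of [z^-m] collects the [g] with
    [2 g - 2 + n = m], all of which are at most [m + 2]. *)
Definition Vser (n : nat) : fps :=
  let g0 := if (n <= 2)%N then 1%N else 0%N in
  FPS (fun m => \sum_(g0 <= g < m.+3 | (2 * g + n == m + 2)%N) chiM g n).

(* Main.v *)
Require Import Defs.
From HB Require Import structures.
From mathcomp Require Import all_boot all_order all_algebra perm.
From mathcomp Require Import boolp classical_sets fsbigop.
From mathcomp Require Import cardinality finmap zify.

Set Implicit Arguments.
Unset Strict Implicit.
Unset Printing Implicit Defensive.
Import Order.TTheory GRing.Theory Num.Theory.

Local Open Scope ring_scope.
Local Open Scope quotient_scope.

(** Both sides count the same stable graphs. A stable graph without external
    edges is a plain graph together with a genus at each vertex; a vertex of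
    genus [a] and valence [n] has the weight [chiM a n] and the exponent
    [2 a - 2 + n] of [z^-1], which is one term of [Vser n]. Expanding the
    product of the series [Vser] over the vertices of a plain graph amounts to
    choosing a genus at each vertex, and the terms present in [Vser n] are
    exactly those that stability allows ([coef_Vser], [coef_prod_choice]).

    The exponents agree because a connected graph has [h^1 = E - V + 1]: the
    coboundary has rank [V - 1] ([rank_coboundary]), so that [2 g - 2] is the
    sum of [2 a_v - 2 + val_v] over the vertices ([genus_negchi]). Each vertex
    contributes at least 1 to that sum, whence [g >= 2] is automatic.

    The symmetry factors agree by orbit-stabilizer. The automorphism group of a
    plain graph acts on its genus assignments; the orbits are the isomorphism
    classes of stable graphs above it and the stabilizers are their automorphism
    groups. Thus the weighted sum of [1/|Aut|] over the stable graphs above a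
    plain graph is the weighted sum over its genus assignments, divided by the
    order of its own automorphism group ([card_orbit_Aut], [fiber_sum]).

    The comparison is made on the coefficient of [z^-m], for which only finitely
    many graphs and genera are involved; finiteness of the sets of classes makes
    the finitely supported sums on both sides genuine sums. *)

(** * Products of formal series *)

Lemma coef_fps_sum I (r : seq I) (P : pred I) (F : I -> fps) m :
  coef (\sum_(i <- r | P i) F i) m = \sum_(i <- r | P i) coef (F i) m.
Proof. exact: (big_morph (coef^~ m) (fun _ _ => erefl) erefl). Qed.

Lemma coef_fpsZ a s m : coef (a *: s) m = a * coef s m.
Proof. by []. Qed.

Definition monomial (c : rat) (e : nat) : fps :=
  FPS (fun m => if m == e then c else 0).

Lemma monomialM c e c' e' :
  monomial c e * monomial c' e' = monomial (c * c') (e + e').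
Proof.
apply: fpsP => m /=; case: (leqP e m) => [le_em|lt_me].
  rewrite (bigD1 (Ordinal (le_em : (e < m.+1)%N))) //= eqxx big1 ?addr0.
    rewrite -(eqn_add2l e) subnKC //.
    by case: eqP => // _; rewrite mulr0.
  by move=> i /eqP ne_ie; case: eqP => [eq_ie|]; [case: ne_ie; apply: val_inj
                                                 |rewrite mul0r].
rewrite big1 => [|i _]; first by case: eqP => // ?; lia.
by case: eqP => [?|]; [have := ltn_ord i; lia|rewrite mul0r].
Qed.

Lemma prod_monomial (I : finType) (c : I -> rat) (e : I -> nat) :
  \prod_i monomial (c i) (e i) = monomial (\prod_i c i) (\sum_i e i).
Proof.
elim/big_rec3: _ => [|i s a m _ ->]; last exact: monomialM.
by apply: fpsP => -[].
Qed.

Lemma coef_prod_congr (I : finType) (F F' : I -> fps) m :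
    (forall i j, (j <= m)%N -> coef (F i) j = coef (F' i) j) ->
  forall j, (j <= m)%N -> coef (\prod_i F i) j = coef (\prod_i F' i) j.
Proof.
move=> eqF; elim/big_rec2: _ => // i s t _ eq_st j le_jm /=.
apply: eq_bigr => l _; rewrite eqF ?eq_st //; have := ltn_ord l; lia.
Qed.

(** If each factor is, up to order [m], a finite sum of monomials indexed by
    ['I_N], then distributing the product turns its coefficient of order [m]
    into a sum over the choices of one monomial in each factor. *)
Lemma coef_prod_choice (I : finType) N m (P : I -> pred 'I_N)
    (c : I -> 'I_N -> rat) (e : I -> 'I_N -> nat) (F : I -> fps) :
    (forall i j, (j <= m)%N ->
       coef (F i) j = \sum_(a | P i a && (e i a == j)) c i a) ->
  coef (\prod_i F i) m =
    \sum_(f : {ffun I -> 'I_N} |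
          [forall i, P i (f i)] && (\sum_i e i (f i) == m)%N)
      \prod_i c i (f i).
Proof.
move=> coefF.
pose F' i : fps := \sum_(a | P i a) monomial (c i a) (e i a).
rewrite (@coef_prod_congr _ F F' m) //; last first.
  move=> i j le_jm; rewrite coefF // coef_fps_sum big_mkcondr /=.
  by apply: eq_bigr => a _; rewrite eq_sym.
rewrite bigA_distr_big_dep coef_fps_sum big_mkcondr /=.
apply: eq_big => [f|f _]; last by rewrite prod_monomial /= eq_sym.
by apply/familyP/forallP.
Qed.

(** * The genus of a connected graph *)

Lemma sum_valence (G : graph) : (\sum_v valence (G := G) v = nhalf G)%N.
Proof.
rewrite -[RHS]card_ord -sum1_card (partition_big (@vert G) predT) //=.
by apply: eq_bigr => v _; rewrite sum1dep_card.
Qed.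

(** In the absence of external edges, the half-edges smaller than their
    opposite form a set of representatives of the edges: an orientation. *)
Definition oriented (G : graph) : {set 'I_(nhalf G)} :=
  [set h : 'I_(nhalf G) | (h < flip h)%N]%SET.

Lemma orientedPn (G : graph) (h : 'I_(nhalf G)) : no_external G ->
  (flip h \in oriented G) = (h \notin oriented G).
Proof.
move=> /forallP /(_ h) fixfree; rewrite !inE flipK -leqNgt.
by rewrite [RHS]leq_eqVlt -[_ == _ :> nat]/(flip h == h) (negPf fixfree).
Qed.

Lemma card_oriented (G : graph) : no_external G -> #|oriented G| = nedges G.
Proof.
move=> noext; rewrite /nedges.
have -> : edges G = [set [set h; flip h] | h in oriented G]%SET.
  apply/setP => e; apply/imsetP/imsetP => -[h _ ->].
    have [h_or|h_nor] := boolP (h \in oriented G); first by exists h.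
    by exists (flip h); rewrite ?orientedPn // flipK finset.setUC.
  by exists h => //; rewrite inE; exact: (forallP noext).
rewrite card_in_imset // => h h' h_or h'_or /setP /(_ h).
rewrite !inE eqxx /= => /esym /orP[/eqP //|/eqP eq_h].
by move: h_or; rewrite eq_h orientedPn // h'_or.
Qed.

Lemma nhalf_nedges (G : graph) : no_external G -> nhalf G = (2 * nedges G)%N.
Proof.
move=> noext; rewrite -card_oriented // -[LHS]card_ord -(cardsC (oriented G)).
suff -> : (~: oriented G = @flip G @: oriented G)%SET.
  by rewrite card_imset ?addnn ?mul2n //; apply: can_inj (@flipK G).
apply/setP => h; rewrite inE -orientedPn //; apply/idP/imsetP => [h_or|].
  by exists (flip h); rewrite ?flipK.
by case=> h' h'_or ->; rewrite flipK.
Qed.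

Lemma coboundary_flip (G : graph) v h :
  coboundary G v (flip h) = - coboundary G v h.
Proof. by rewrite !mxE flipK opprB. Qed.

(** The columns of an orientation span the column space, the columns of [h] and
    [flip h] being opposite. The bound makes the subtraction in [h1] exact. *)
Lemma rank_coboundary_le (G : graph) :
  no_external G -> (\rank (coboundary G) <= nedges G)%N.
Proof.
move=> noext; rewrite -card_oriented // -mxrank_tr.
pose A := rowsub (@enum_val _ (mem (oriented G))) (coboundary G)^T.
apply: leq_trans (rank_leq_row A); apply: mxrankS; apply/row_subP => h.
wlog h_or : h / h \in oriented G => [main|].
  have [/main //|h_nor] := boolP (h \in oriented G).
  have -> : row h (coboundary G)^T = (- 1) *: row (flip h) (coboundary G)^T.
    apply/rowP => v; have := coboundary_flip v h.
    by rewrite !mxE mulN1r => ->; rewrite opprK.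
  by apply/scalemx_sub/main; rewrite orientedPn.
have -> : row h (coboundary G)^T = row (enum_rank_in h_or h) A.
  by rewrite row_rowsub enum_rankK_in.
exact: row_sub.
Qed.

(** The kernel of the coboundary consists of the functions that take the same
    value at both ends of each edge; on a connected graph, these are the
    constants. *)
Lemma rank_coboundary (G : graph) :
  connected_graph G -> (\rank (coboundary G)).+1 = nvert G.
Proof.
case/andP => nv_gt0 /forallP conn.
pose K : 'rV[rat]_(nvert G) := const_mx 1; pose v0 := Ordinal nv_gt0.
have kerE : (kermx (coboundary G) == K)%MS.
  apply/andP; split; last first.
    apply/sub_kermxP/rowP => h; rewrite !mxE.
    under eq_bigr do rewrite !mxE mul1r.
    rewrite sumrB (bigD1 (vert h)) //= eqxx big1 ?addr0; last first.
      by move=> v; rewrite eq_sym => /negPf ->.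
    rewrite (bigD1 (vert (flip h))) //= eqxx big1 ?addr0 ?subrr //.
    by move=> v; rewrite eq_sym => /negPf ->.
  apply/rV_subP => u /sub_kermxP /rowP ker_u.
  have ends h : u 0 (vert h) = u 0 (vert (flip h)).
    have sum_delta w : \sum_v u 0 v * (w == v)%:R = u 0 w.
      rewrite (bigD1 w) //= eqxx mulr1 big1 ?addr0 // => v.
      by rewrite eq_sym => /negPf ->; rewrite mulr0.
    apply/eqP; rewrite -subr_eq0 -!sum_delta -sumrB; apply/eqP.
    transitivity ((u *m coboundary G) 0 h); last by rewrite ker_u mxE.
    rewrite [RHS]mxE; apply: eq_bigr => v _.
    by rewrite [coboundary G v h]mxE mulrBr.
  have const_u w : u 0 w = u 0 v0.
    have /connectP[p] := forallP (conn v0) w.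
    elim: p {conn nv_gt0} v0 => /= [|x p IH] w0; first by move=> _ ->.
    case/andP => /existsP[h /andP[/eqP <- /eqP <-]] path_p last_p.
    by rewrite ends; apply: IH.
  apply/sub_rVP; exists (u 0 v0); apply/rowP => w.
  by rewrite !mxE mulr1 const_u.
have : \rank (kermx (coboundary G)) = 1%N.
  rewrite (eqmxP kerE) rank_rV; case: eqP => // /rowP /(_ v0) /eqP.
  by rewrite !mxE oner_eq0.
rewrite mxrank_ker; lia.
Qed.

(** Minus the Euler characteristic of a smoothing of the nodal curves described
    by a stable graph, collected vertex by vertex: each term is that of a
    component punctured at its nodes. Stability makes each subtraction exact. *)
Definition negchi (G : ggraph) : nat :=
  \sum_(v < nvert G) (2 * vgenus v + valence v - 2).

Lemma stable_negchi (G : ggraph) : stable G ->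
  (negchi G + 2 * nvert G
   = 2 * (\sum_v vgenus (g := G) v) + nhalf G)%N.
Proof.
move=> /forallP st; rewrite /negchi -sum_valence big_distrr -big_split /=.
have -> : (2 * nvert G = \sum_(v < nvert G) 2)%N.
  by rewrite sum_nat_const card_ord mulnC.
rewrite -big_split; apply: eq_bigr => v _ /=; have := st v; lia.
Qed.

Lemma genus_negchi (G : ggraph) : connected_graph G -> no_external G ->
  stable G -> (2 * genus G = negchi G + 2)%N.
Proof.
move=> conn noext st; have := stable_negchi st; have := rank_coboundary conn.
have := rank_coboundary_le noext; have := nhalf_nedges noext.
rewrite /genus /h1; lia.
Qed.

Lemma negchi_gt (G : ggraph) : stable G -> (nvert G <= negchi G)%N.
Proof.
move=> /forallP st; rewrite -[X in (X <= _)%N]card_ord -sum1_card.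
by apply: leq_sum => v _; have := st v; lia.
Qed.

Lemma vgenus_le (G : ggraph) (v : 'I_(nvert G)) :
  (2 * vgenus v + valence v <= negchi G + 2)%N.
Proof. by rewrite /negchi (bigD1 v) //=; lia. Qed.

(** A vertex without half-edges would be a connected component on its own. *)
Lemma valence_gt0 (G : graph) (v : 'I_(nvert G)) :
  connected_graph G -> (0 < nhalf G)%N -> (0 < valence v)%N.
Proof.
case/andP => _ /forallP /(_ v) /forallP conn nh_gt0.
pose h := Ordinal nh_gt0; apply/card_gt0P.
have /connectP[[|w p] /=] := conn (vert h).
  by move=> _ eq_v; exists h; rewrite inE eq_v.
by case/andP => /existsP[h' /andP[? _]] _ _; exists h'; rewrite inE.
Qed.

(** * Invariance under isomorphism *)

Section Isomorphism.
Variables (G H : graph) (f : 'I_(nvert G) -> 'I_(nvert H)).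
Variable (p : 'I_(nhalf G) -> 'I_(nhalf H)).
Hypotheses (f_bij : bijective f) (p_bij : bijective p) (fp : graph_mor f p).

Let vertE h : vert (p h) = f (vert h).
Proof. by case/andP: fp => /forallP /(_ h) /eqP. Qed.

Let flipE h : flip (p h) = p (flip h).
Proof. by case/andP: fp => _ /forallP /(_ h) /eqP. Qed.

Lemma iso_valence v : valence (f v) = valence v.
Proof.
rewrite /valence -(card_imset _ (bij_inj p_bij)); apply: eq_card => h'.
have [p' pK p'K] := p_bij; rewrite inE; apply/eqP/imsetP => [eq_v|[h]].
  by exists (p' h'); rewrite ?inE // -(inj_eq (bij_inj f_bij)) -vertE p'K eq_v.
by rewrite inE => /eqP <- ->.
Qed.

Lemma iso_nhalf : nhalf G = nhalf H.
Proof. by have := bij_eq_card p_bij; rewrite !card_ord. Qed.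

Lemma iso_no_external : no_external G -> no_external H.
Proof.
move=> /forallP noext; apply/forallP => h'; have [p' _ p'K] := p_bij.
by rewrite -(p'K h') flipE (inj_eq (bij_inj p_bij)).
Qed.

Lemma iso_nedges : no_external G -> nedges H = nedges G.
Proof.
move=> noext; have := nhalf_nedges noext.
have := nhalf_nedges (iso_no_external noext); have := iso_nhalf; lia.
Qed.

Lemma iso_connected : connected_graph G -> connected_graph H.
Proof.
case/andP => nv_gt0 /forallP conn; have [f' _ f'K] := f_bij.
apply/andP; split; first exact: leq_trans (ltn_ord (f (Ordinal nv_gt0))).
apply/forallP => u; apply/forallP => v; rewrite -(f'K u) -(f'K v).
have /connectP[s] := forallP (conn (f' u)) (f' v).
elim: s (f' u) => /= [|x s IH] w; first by move=> _ ->.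
case/andP => /existsP[h /andP[/eqP <- /eqP <-]] path_s last_s.
apply: (connect_trans (connect1 _) (IH _ path_s last_s)).
by apply/existsP; exists (p h); rewrite flipE !vertE !eqxx.
Qed.

End Isomorphism.

Definition vertex_weight (G : ggraph) : rat :=
  \prod_(v < nvert G) chiM (vgenus v) (valence v).

(** The graphs with a term in the coefficient of [z^-m] of either side; the
    order [m] is read off the vertices, so that isomorphism invariance does not
    go through [h1]. *)
Definition contributes (k m : nat) (G : ggraph) : bool :=
  [&& connected_graph G, stable G, no_external G,
      nedges G == k & negchi G == m].

Section GenusIsomorphism.
Variables G H : ggraph.
Hypothesis isoGH : ggraph_iso G H.

Lemma ggraph_iso_graph : graph_iso G H.
Proof.
have /asboolP[f [p [f_bij p_bij /andP[fp _]]]] := isoGH.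
by apply/asboolP; exists f, p.
Qed.

Lemma iso_vertex_weight : vertex_weight G = vertex_weight H.
Proof.
have /asboolP[f [p [f_bij p_bij /andP[fp /forallP gf]]]] := isoGH.
rewrite /vertex_weight [RHS](reindex f); last exact: onW_bij.
by apply: eq_bigr => v _; rewrite (eqP (gf v)) (iso_valence f_bij p_bij fp).
Qed.

Lemma iso_negchi : negchi G = negchi H.
Proof.
have /asboolP[f [p [f_bij p_bij /andP[fp /forallP gf]]]] := isoGH.
rewrite /negchi [RHS](reindex f); last exact: onW_bij.
by apply: eq_bigr => v _; rewrite (eqP (gf v)) (iso_valence f_bij p_bij fp).
Qed.

Lemma iso_stable : stable G -> stable H.
Proof.
have /asboolP[f [p [f_bij p_bij /andP[fp /forallP gf]]]] := isoGH.
move=> /forallP st; apply/forallP => v; have [f' _ f'K] := f_bij.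
by rewrite -(f'K v) (eqP (gf _)) (iso_valence f_bij p_bij fp).
Qed.

Lemma iso_contributes_imp k m : contributes k m G -> contributes k m H.
Proof.
have /asboolP[f [p [f_bij p_bij /andP[fp _]]]] := isoGH.
case/and5P => conn st noext ek em; apply/and5P; split.
- exact: iso_connected fp conn.
- exact: iso_stable.
- exact: iso_no_external fp noext.
- by rewrite (iso_nedges p_bij fp noext).
- by rewrite -iso_negchi.
Qed.

End GenusIsomorphism.

Lemma iso_contributes k m G H :
  ggraph_iso G H -> contributes k m G = contributes k m H.
Proof.
move=> isoGH; apply/idP/idP; apply: iso_contributes_imp => //.
by rewrite ggraph_iso_sym.
Qed.

Lemma ggraph_AutP (G : ggraph) (s : 'S_(nvert G) * 'S_(nhalf G)) :
  reflect [/\ forall h, vert (s.2 h) = s.1 (vert h),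
              forall h, flip (s.2 h) = s.2 (flip h)
            & forall v, vgenus (s.1 v) = vgenus v] (s \in ggraph_Aut G).
Proof.
rewrite inE; apply: (iffP andP).
  by move=> [/andP[/forallP sv /forallP sf] /forallP sg]; split=> x; apply/eqP.
by case=> sv sf sg; do 1?[split]; rewrite /graph_mor;
  [apply/andP; split|]; apply/forallP => x; apply/eqP.
Qed.

(** Conjugation by an isomorphism embeds one automorphism group in the other. *)
Lemma leq_card_Aut G H :
  ggraph_iso G H -> (#|ggraph_Aut G| <= #|ggraph_Aut H|)%N.
Proof.
move=> /asboolP[f [p [[f' fK f'K] [p' pK p'K] fpg]]].
case/andP: fpg => /andP[/forallP fv /forallP ff] /forallP fg.
have inj_f s : injective (f \o perm.fun_of_perm s \o f').
  exact: inj_comp (inj_comp (can_inj fK) (@perm_inj _ s)) (can_inj f'K).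
have inj_p s : injective (p \o perm.fun_of_perm s \o p').
  exact: inj_comp (inj_comp (can_inj pK) (@perm_inj _ s)) (can_inj p'K).
pose conj s := (perm (inj_f s.1), perm (inj_p s.2)).
have conj_inj : injective conj.
  move=> [s t] [s' t'] [/permP eq_s /permP eq_t]; congr pair; apply/permP => x.
    by apply: (can_inj fK); have := eq_s (f x); rewrite !permE /= fK.
  by apply: (can_inj pK); have := eq_t (p x); rewrite !permE /= pK.
rewrite -(card_imset _ conj_inj).
apply: fintype.subset_leq_card; apply/fintype.subsetP => t.
case/imsetP => s /ggraph_AutP[sv sf sg] -> {t}; apply/ggraph_AutP.
have vE h' : f' (vert h') = vert (p' h').
  by rewrite -{1}(p'K h') (eqP (fv _)) fK.
have fE h' : p' (flip h') = flip (p' h').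
  by rewrite -{1}(p'K h') (eqP (ff _)) pK.
split=> x; rewrite !permE /=.
- by rewrite (eqP (fv _)) sv vE.
- by rewrite (eqP (ff _)) sf fE.
- by rewrite (eqP (fg _)) sg -(eqP (fg _)) f'K.
Qed.

Lemma iso_card_Aut G H : ggraph_iso G H -> #|ggraph_Aut G| = #|ggraph_Aut H|.
Proof.
by move=> isoGH; apply/eqP; rewrite eqn_leq !leq_card_Aut // ggraph_iso_sym.
Qed.

(** * Finiteness *)

(** Labelled graphs with bounded data are finitely many on the nose, and classes
    are covered by their representatives. *)
Definition bounded (N : nat) : set ggraph :=
  [set G : ggraph | [/\ (nvert G <= N)%N, (nhalf G <= N)%N
                      & forall v : 'I_(nvert G), (vgenus v <= N)%N]]%classic.

Lemma finite_bounded N : finite_set (bounded N).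
Proof.
pose I n h := ({ffun 'I_h -> 'I_n}
  * {p : {ffun 'I_h -> 'I_h} | [forall x, p (p x) == x]}
  * {ffun 'I_n -> 'I_N.+1})%type.
have involP h (p : {p : {ffun 'I_h -> 'I_h} | [forall x, p (p x) == x]}) :
    involutive (val p).
  by move=> x; apply/eqP; move: x; apply/forallP: (valP p).
pose decode n h (x : I n h) : ggraph :=
  @GGraph (@Graph n h x.1.1 (val x.1.2) (@involP h x.1.2))
          (fun v => x.2 v).
apply: (@sub_finite_set _ _ (\bigcup_(n in `I_N.+1) \bigcup_(h in `I_N.+1)
          (@decode n h @` [set: I n h])))%classic; last first.
  apply: bigcup_finite => [|n _]; first exact: finite_II.
  apply: bigcup_finite => [|h _]; first exact: finite_II.
  by apply: finite_image; apply: finite_finset.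
case=> -[n h v f fK] /= g [/= le_n le_h le_g]; exists n => //=; exists h => //=.
have fK' : [forall x, [ffun y => f y] ([ffun y => f y] x) == x].
  by apply/forallP => x; rewrite !ffunE fK.
exists ([ffun x => v x],
        exist (fun p : {ffun 'I_h -> 'I_h} => [forall x, p (p x) == x])
          [ffun x => f x] fK',
        [ffun w => inord (g w)]) => //.
rewrite /decode /=.
(* The two graphs differ only by extensionality and by the proof of the
   involution, generalized first so that its type can be rewritten. *)
set fK'' := involP _ _; move: fK''; rewrite /= => fK''.
have ev : ([ffun x => v x] : _ -> _) = v by apply/funext => x; rewrite ffunE.
have ef : ([ffun x => f x] : _ -> _) = f by apply/funext => x; rewrite ffunE.
have eg : (fun w => nat_of_ord ([ffun w => inord (g w)] w : 'I_N.+1)) = g.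
  by apply/funext => w; rewrite ffunE inordK // ltnS le_g.
move: fK''; rewrite ev ef eg => fK''.
by rewrite (Prop_irrelevance fK'' fK).
Qed.

Lemma finite_ggraph_class (A : set ggraph_class) N :
  (forall c, A c -> bounded N (repr c)) -> finite_set A.
Proof.
move=> bound; apply: sub_finite_set (finite_image _ (finite_bounded N)).
by move=> c /bound bc; exists (repr c) => //; exact: (reprK c).
Qed.

Lemma finite_graph_class (A : set graph_class) N :
    (forall c, A c -> (nvert (repr c) <= N)%N /\ (nhalf (repr c) <= N)%N) ->
  finite_set A.
Proof.
move=> bound.
apply: sub_finite_set (finite_image
  (fun G : ggraph => \pi_graph_class (ggraph_graph G)) (finite_bounded N)).
move=> c /bound[len leh]; exists (@GGraph (repr c) (fun=> 0%N)) => //.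
exact: reprK.
Qed.

Lemma nvert_le (G : graph) : connected_graph G -> no_external G ->
  (nvert G <= (nedges G).+1)%N.
Proof.
move=> conn /rank_coboundary_le; have := rank_coboundary conn; lia.
Qed.

Lemma finite_plain_graphs k : finite_set (plain_graphs k).
Proof.
apply: (@finite_graph_class _ (k.*2 + 1)) => c /and3P[conn noext /eqP ek].
have := nvert_le conn noext; have := nhalf_nedges noext; lia.
Qed.

(** Each vertex contributes at least 1 to [2 g - 2], which bounds the vertices
    and then everything else. *)
Lemma finite_stable_graphs g : finite_set (stable_graphs g).
Proof.
(* [V <= 2 g - 2], and [nhalf <= 2 g - 2 + 2 V <= 6 g]. *)
apply: (@finite_ggraph_class _ (6 * g)) => c /and4P[conn st noext /eqP eg].
have := genus_negchi conn noext st; have := negchi_gt st.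
have := stable_negchi st; rewrite eg => e1 e2 e3.
split; try lia; move=> v; have := vgenus_le v; lia.
Qed.

(** * Genus assignments on a graph *)

Definition with_genus (G : graph) N
    (f : {ffun 'I_(nvert G) -> 'I_N}) : ggraph :=
  @GGraph G (fun v => f v).

Section GenusAssignments.
Variables (G : graph) (N : nat).
Implicit Types f : {ffun 'I_(nvert G) -> 'I_N}.
Implicit Types s t : 'S_(nvert G) * 'S_(nhalf G).

Let act f s : {ffun 'I_(nvert G) -> 'I_N} := [ffun v => f (s.1 v)].

Let mulp t s := ((t.1 * s.1)%g, (t.2 * s.2)%g).
Let invp t : 'S_(nvert G) * 'S_(nhalf G) := (t.1^-1%g, t.2^-1%g).

Let Aut_mul t s : t \in graph_Aut G -> s \in graph_Aut G ->
  mulp t s \in graph_Aut G.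
Proof.
rewrite !inE => tG sG; have := graph_mor_comp tG sG.
by congr (_ && _); apply: eq_forallb => h; rewrite !permM.
Qed.

Let Aut_inv t : t \in graph_Aut G -> invp t \in graph_Aut G.
Proof.
rewrite !inE.
by apply: graph_mor_inv; [exact: permK|exact: permKV|exact: permK].
Qed.

Lemma with_genus_isoP f0 f :
  reflect (exists2 s, s \in graph_Aut G & act f0 s = f)
          (ggraph_iso (with_genus f) (with_genus f0)).
Proof.
apply: (iffP (asboolP _)) => [[a [p [a_bij p_bij /andP[ap /forallP ag]]]]|].
  exists (perm (bij_inj a_bij), perm (bij_inj p_bij)).
    rewrite inE; move: ap; congr (_ && _); apply: eq_forallb => h;
    by rewrite !permE.
  apply/ffunP => v; rewrite ffunE permE; apply: val_inj; exact/eqP/(ag v).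
case=> s; rewrite inE => sG <-; exists s.1, s.2.
split; [exact: injF_bij perm_inj|exact: injF_bij perm_inj|].
apply/andP; split=> //.
by apply/forallP => v /=; rewrite ffunE.
Qed.

(** The automorphisms of the graph act on the genus assignments; an orbit is an
    isomorphism class and the stabilizer is the automorphism group of the graph
    with genera, hence the equality by counting the fibres of an orbit map. *)
Lemma card_orbit_Aut f0 :
  (#|[set f : {ffun 'I_(nvert G) -> 'I_N} |
       ggraph_iso (with_genus f) (with_genus f0)]%SET|
     * #|ggraph_Aut (with_genus f0)| = #|graph_Aut G|)%N.
Proof.
set B := [set f | _]%SET.
rewrite -[RHS]sum1_card (partition_big (act f0) [in B]) => [|s sG]; last first.
  by rewrite inE; apply/with_genus_isoP; exists s.
rewrite -sum_nat_const; apply: eq_bigr => f; rewrite inE.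
case/with_genus_isoP => t tG <-; rewrite sum1dep_card.
(* The fibre over [act f0 t] is the translate by [t] of the stabilizer. *)
have mulp_inj : injective (mulp t).
  by move=> [s1 s2] [s1' s2'] [/mulgI -> /mulgI ->].
rewrite -(card_imset (ggraph_Aut (with_genus f0)) mulp_inj).
apply: eq_card => u; rewrite [RHS]inE.
apply/imsetP/andP => [[s]|[uG /eqP act_u]].
  rewrite inE => /andP[sG /forallP sg] ->; split.
    by apply: Aut_mul => //; rewrite inE.
  apply/eqP/ffunP => v; rewrite !ffunE permM.
  by apply: val_inj; apply/eqP/(sg (t.1 v)).
exists (mulp (invp t) u); last first.
  by case: u {uG act_u} => u1 u2; rewrite /mulp /= !mulVKg.
rewrite inE; apply/andP; split.
  by have := Aut_mul (Aut_inv tG) uG; rewrite inE.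
apply/forallP => v /=; move/ffunP/(_ (t.1^-1 v)%g): act_u.
by rewrite !ffunE permM permKV => ->.
Qed.
End GenusAssignments.

(** * Summing over isomorphism classes *)

Definition class_weight (c : ggraph_class) : rat :=
  #|ggraph_Aut (repr c)|%:R^-1 * vertex_weight (repr c).

Definition forget (c : ggraph_class) : graph_class :=
  \pi_graph_class (ggraph_graph (repr c)).

Definition contributing k m : set ggraph_class :=
  [set c : ggraph_class | contributes k m (repr c)]%classic.

Lemma piP_ggraph G H :
  reflect (\pi_ggraph_class G = \pi_ggraph_class H) (ggraph_iso G H).
Proof. exact: eqquotP. Qed.

Lemma piP_graph G H :
  reflect (\pi_graph_class G = \pi_graph_class H) (graph_iso G H).
Proof. exact: eqquotP. Qed.

Lemma iso_repr G : ggraph_iso (repr (\pi_ggraph_class G)) G.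
Proof. by apply/piP_ggraph; rewrite reprK. Qed.

Lemma forget_pi G :
  forget (\pi_ggraph_class G) = \pi_graph_class (ggraph_graph G).
Proof. exact/piP_graph/ggraph_iso_graph/iso_repr. Qed.

Lemma card_graph_Aut_gt0 G : (0 < #|graph_Aut G|)%N.
Proof.
apply/card_gt0P; exists (1%g, 1%g); rewrite inE.
have := graph_mor_id G; congr (_ && _); apply: eq_forallb => h;
by rewrite !perm1.
Qed.

Lemma forget_plain k m c : contributes k m (repr c) ->
  [&& connected_graph (repr (forget c)), no_external (repr (forget c))
    & nedges (repr (forget c)) == k].
Proof.
case/and5P => conn _ noext /eqP ek _.
have /asboolP[f [p [f_bij p_bij fp]]] : graph_iso (repr c) (repr (forget c)).
  by apply/piP_graph; rewrite reprK.
apply/and3P; split; first exact: iso_connected fp conn.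
  exact: iso_no_external fp noext.
by rewrite (iso_nedges p_bij fp noext) ek.
Qed.

Lemma contributes_bounded k m G : contributes k m G ->
  forall v : 'I_(nvert G), (vgenus v < m.+3)%N.
Proof. by case/and5P => _ _ _ _ /eqP <- v; have := vgenus_le v; lia. Qed.

(** The weight of a class is an average over the genus assignments realizing it
    on a fixed underlying graph, by the count of an orbit. *)
Lemma class_weight_orbit k m G c : contributes k m (repr c) ->
    forget c = \pi_graph_class G ->
  class_weight c = #|graph_Aut G|%:R^-1 *
    \sum_(f : {ffun 'I_(nvert G) -> 'I_m.+3} |
          \pi_ggraph_class (with_genus f) == c)
       vertex_weight (with_genus f).
Proof.
move=> cont_c /piP_graph /asboolP[a [p [a_bij p_bij ap]]].
have [a' aK a'K] := a_bij.
pose f0 : {ffun 'I_(nvert G) -> 'I_m.+3} := [ffun v => inord (vgenus (a' v))].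
have iso0 : ggraph_iso (repr c) (with_genus f0).
  apply/asboolP; exists a, p; split=> //; apply/andP; split=> //.
  apply/forallP => v.
  by rewrite /= ffunE aK inordK ?(contributes_bounded cont_c).
have pi0 : \pi_ggraph_class (with_genus f0) = c.
  by rewrite -[RHS]reprK; apply/esym/piP_ggraph.
pose B := [set f : {ffun 'I_(nvert G) -> 'I_m.+3} |
             ggraph_iso (with_genus f) (with_genus f0)]%SET.
rewrite (eq_bigl (fun f => f \in B)) => [|f]; last first.
  by rewrite inE -pi0; apply/eqP/piP_ggraph.
rewrite (eq_bigr (fun=> vertex_weight (repr c))) => [|f]; last first.
  by rewrite inE (iso_vertex_weight iso0) => /iso_vertex_weight.
rewrite sumr_const /class_weight (iso_card_Aut iso0) -(card_orbit_Aut f0).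
have := card_graph_Aut_gt0 G; rewrite -(card_orbit_Aut f0) muln_gt0.
case/andP; rewrite -!(ltr0n rat) natrM -[vertex_weight _ *+ _]mulr_natl -/B.
move=> /lt0r_neq0 B_neq0 /lt0r_neq0 A_neq0.
by rewrite invfM mulrACA mulVf // mul1r.
Qed.

(** Each genus assignment on [G] belongs to exactly one class, so that the
    averages of the classes above [G] add up to one sum over all assignments. *)
Lemma fiber_sum k m (G : graph) (A : seq ggraph_class) :
    uniq A -> (forall c, (c \in A) = contributes k m (repr c)) ->
  \sum_(c <- A | forget c == \pi_graph_class G) class_weight c =
  #|graph_Aut G|%:R^-1 *
    \sum_(f : {ffun 'I_(nvert G) -> 'I_m.+3} | contributes k m (with_genus f))
       vertex_weight (with_genus f).
Proof.
move=> A_uniq memA.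
pose Cf (f : {ffun 'I_(nvert G) -> 'I_m.+3}) := contributes k m (with_genus f).
transitivity (\sum_(c <- A | forget c == \pi_graph_class G)
  #|graph_Aut G|%:R^-1 *
  \sum_(f : {ffun 'I_(nvert G) -> 'I_m.+3} |
         Cf f && (\pi_ggraph_class (with_genus f) == c))
    vertex_weight (with_genus f)).
  rewrite [LHS]big_seq_cond [RHS]big_seq_cond; apply: eq_bigr => c.
  rewrite memA => /andP[cont_c /eqP forget_c].
  rewrite (class_weight_orbit cont_c forget_c); congr (_ * _).
  apply: eq_bigl => f; case: eqP => [pi_f|]; rewrite ?andbF ?andbT //.
  by rewrite /Cf -(iso_contributes k m (iso_repr (with_genus f))) pi_f cont_c.
rewrite -big_distrr /= (exchange_big_dep Cf) => [|c f _ /andP[] //].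
congr (_ * _).
apply: eq_bigr => f cont_f.
rewrite (eq_bigl (pred1 (\pi_ggraph_class (with_genus f)))) => [|c]; last first.
  apply/andP/eqP => [[_ /andP[_ /eqP ->]] //|->]; split; last exact/andP.
  by rewrite forget_pi.
rewrite -big_filter filter_pred1_uniq ?big_seq1 //.
by rewrite memA (iso_contributes k m (iso_repr _)).
Qed.

(** * Coefficients of both sides *)

Lemma contributes_genus k m G :
  contributes k m G -> (2 * genus G = m + 2)%N /\ (0 < m)%N.
Proof.
case/and5P=> conn st noext _ /eqP em; rewrite genus_negchi // em; split=> //.
by rewrite -em; apply: leq_trans (negchi_gt st); case/andP: conn.
Qed.

Lemma contributesE k m g G : (2 * g = m + 2)%N ->
  contributes k m G =
  [&& connected_graph G, stable G, no_external G & genus G == g]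
    && (nedges G == k).
Proof.
move=> eg; rewrite /contributes.
have [conn|] //= := boolP (connected_graph G).
have [st|] //= := boolP (stable G); have [noext|] //= := boolP (no_external G).
rewrite andbC; congr (_ && _); have := genus_negchi conn noext st; lia.
Qed.

Lemma finite_contributing k m : finite_set (contributing k m).
Proof.
apply: sub_finite_set (finite_stable_graphs m./2.+1) => c /= cont_c.
have [eg _] := contributes_genus cont_c.
have e : (2 * m./2.+1 = m + 2)%N by lia.
move: cont_c; rewrite /contributing /stable_graphs /= (contributesE _ _ e).
by case/andP.
Qed.

Lemma acoefE g k :
  acoef g k = \sum_(c \in stable_graphs g)
                (if nedges (repr c) == k then class_weight c else 0).
Proof.
rewrite /acoef /tchi !(fsbig_finite _ _ (finite_stable_graphs g)) coef_sum.
apply: eq_bigr => c _; rewrite coefZ coefXn eq_sym.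
by case: eqP => _; rewrite ?mulr1 ?mulr0.
Qed.

Lemma coef_Gser k m :
  coef (Gser k) m = \sum_(c \in contributing k m) class_weight c.
Proof.
have genE g : (2 * g == m + 2)%N = ~~ odd m && (g == m./2.+1) by lia.
rewrite /=; under eq_bigl => g do rewrite genE.
(* The excluded values of [m], odd or zero, are those of no stable graph. *)
rewrite big_nat1_cond_eq; case: ifP => [/andP[le_m m_even]|out]; last first.
  rewrite (_ : contributing k m = set0) ?fsbig_set0 //.
  rewrite -subset0 => c /= /contributes_genus; move: out; lia.
have e : (2 * m./2.+1 = m + 2)%N by lia.
rewrite acoefE (fsbig_finite _ _ (finite_stable_graphs _)).
rewrite (fsbig_finite _ _ (finite_contributing k m)) -big_mkcond -big_filter.
apply: perm_big; apply: uniq_perm; rewrite ?filter_uniq ?fset_uniq // => c.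
rewrite mem_filter !in_fset_set //;
  [|exact: finite_contributing|exact: finite_stable_graphs].
rewrite /stable_graphs /contributing; apply/idP/idP.
  case/andP=> ek /set_mem /= st; apply/mem_set; rewrite /= (contributesE _ _ e).
  by rewrite ek andbT.
move=> /set_mem /=; rewrite (contributesE _ _ e) andbC => /andP[-> ?].
exact/mem_set.
Qed.

(** The genera kept by [Vser n] are those that stability allows at a vertex of
    valence [n]; for [n = 0] this fails, genus 1 having exponent 0 without being
    stable. *)
Lemma coef_Vser n m j : (0 < n)%N -> (j <= m)%N ->
  coef (Vser n) j =
  \sum_(a < m.+3 | (2 < 2 * a + n)%N && (2 * a + n - 2 == j)%N) chiM a n.
Proof.
move=> n_gt0 le_jm /=; set g0 := if _ then _ else _.
(* Genera below the starting point of [Vser n] are unstable, and those from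
   [j + 3] on have too large an exponent. *)
rewrite -(big_mkord (fun a => (2 < 2 * a + n) && (2 * a + n - 2 == j))%N
                    (fun a => chiM a n)).
have le_g0 : (g0 <= j.+3)%N by rewrite /g0; case: ifP.
rewrite [RHS](@big_cat_nat _ _ _ g0) //=; last by apply: leq_trans le_g0 _; lia.
rewrite [X in X + _]big_nat_cond [X in X + _]big1 ?add0r; last first.
  by move=> a; rewrite /g0; case: ifP; lia.
rewrite [RHS](@big_cat_nat _ _ _ j.+3) //=.
rewrite [X in _ + X]big_nat_cond [X in _ + X]big1 ?addr0; last first.
  by move=> a ?; exfalso; lia.
rewrite big_nat_cond [RHS]big_nat_cond; apply: eq_bigl => a.
by rewrite /g0; case: ifP; lia.
Qed.

Lemma coef_prod_Vser k m G : (0 < k)%N ->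
    connected_graph G -> no_external G -> nedges G = k ->
  coef (\prod_(v < nvert G) Vser (valence v)) m =
  \sum_(f : {ffun 'I_(nvert G) -> 'I_m.+3} | contributes k m (with_genus f))
     vertex_weight (with_genus f).
Proof.
move=> k_gt0 conn noext ek.
have val_gt0 v : (0 < valence (G := G) v)%N.
  by apply: valence_gt0 => //; rewrite nhalf_nedges // ek; lia.
rewrite (@coef_prod_choice _ m.+3 m
  (fun v a => 2 < 2 * a + valence v)%N (fun v a => chiM a (valence v))
  (fun v a => 2 * a + valence v - 2)%N); last first.
  by move=> v j le_jm; apply: coef_Vser.
apply: eq_bigl => f; rewrite /contributes conn noext ek eqxx /=.
by rewrite /stable /negchi.
Qed.

Theorem theorem4p3 (k : nat) (hk : (1 <= k)%N) :
  Gser k = \sum_(c \in plain_graphs k)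
    #|graph_Aut (repr c)|%:R^-1 *: \prod_(v < nvert (repr c)) Vser (valence v).
Proof.
apply: fpsP => m; rewrite coef_Gser.
rewrite (fsbig_finite _ _ (finite_plain_graphs k)) coef_fps_sum.
rewrite (fsbig_finite _ _ (finite_contributing k m)).
set A := fset_set (contributing k m); set B := fset_set (plain_graphs k).
have memA c : (c \in (A : seq _)) = contributes k m (repr c).
  rewrite [LHS]in_fset_set; last exact: finite_contributing.
  by apply/idP/idP => [/set_mem|c_in]; last exact/mem_set.
have memB d : (d \in (B : seq _)) =
    [&& connected_graph (repr d), no_external (repr d) & nedges (repr d) == k].
  rewrite [LHS]in_fset_set; last exact: finite_plain_graphs.
  by apply/idP/idP => [/set_mem|c_in]; last exact/mem_set.
(* Classes of stable graphs are grouped by their underlying plain graph. *)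
transitivity (\sum_(d <- B) \sum_(c <- A | forget c == d) class_weight c).
  rewrite (exchange_big_dep predT) //= !big_seq; apply: eq_bigr => c.
  rewrite memA => /forget_plain forget_c; rewrite -big_filter.
  rewrite (eq_filter (a2 := pred1 (forget c))) => [|d]; last first.
    by rewrite /= eq_sym.
  by rewrite filter_pred1_uniq ?big_seq1 ?fset_uniq ?memB.
rewrite !big_seq; apply: eq_bigr => d.
rewrite memB => /and3P[conn noext /eqP ek].
rewrite -{1}[d]reprK (fiber_sum _ _ memA) ?fset_uniq //.
by rewrite coef_fpsZ (coef_prod_Vser _ hk).
Qed.
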